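(* Let $\pi$ be a permutation of $[n]$, $n\ge 1$, with factorization $\pi=\pi_1\pi_2\cdots\pi_q$ into indecomposable components. Then $\pi$ is full if and only if each component $\pi_j$ is full.
   Context: $[n]=\{1,\dots,n\}$; one-line notation, products are concatenations. The permutation matrix of a permutation $a_1\cdots a_n$ of $[n]$ has a $1$ in row $n+1-a_j$, column $j$. Bootstrap percolation: a cell is mutable if it contains $0$ and at least two of its orthogonal neighbours contain $1$; mutable cells are changed to $1$ one at a time until none remain (final configuration independent of the order). A permutation of $[k]$ is full if the final configuration is the all-ones $k\times k$ matrix. For a word $w$ of distinct integers, its reduced form replaces the $i$-th smallest entry by $i$; $w$ is full (resp. indecomposable) if its reduced form is. A permutation $\sigma$ of $[k]$ is indecomposable if there is no $1\le j<k$ with $\sigma(\{1,\dots,j\})=\{1,\dots,j\}$. Indecomposable components: $\pi_1$ is the longest indecomposable prefix of $\pi$, and the remaining components are obtained recursively from the remaining word. *)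

(* Defs.v *)
From mathcomp Require Import all_boot all_algebra.

Set Implicit Arguments.
Unset Strict Implicit.
Unset Printing Implicit Defensive.

Section BootstrapPercolation.

Variable k : nat.
Implicit Types A B C : 'M[bool]_k.

Definition adjacent (c d : 'I_k * 'I_k) : bool :=
  (c.1 == d.1) && ((c.2.+1 == d.2) || (d.2.+1 == c.2))
  || (c.2 == d.2) && ((c.1.+1 == d.1) || (d.1.+1 == c.1)).

Definition mutable A (c : 'I_k * 'I_k) : bool :=
  ~~ A c.1 c.2 && (2 <= #|[set d | adjacent c d && A d.1 d.2]|).

Definition infect A (c : 'I_k * 'I_k) : 'M[bool]_k :=
  (\matrix_(i, j) (((i, j) == c) || A i j))%R.

Definition step : rel 'M[bool]_k :=
  fun A B => [exists c, mutable A c && (B == infect A c)].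

Definition stable A : bool := [forall c, ~~ mutable A c].

Definition final_config A B : bool := connect step A B && stable B.

End BootstrapPercolation.

(* A permutation a_1 ... a_n of {1, ..., n} is its one-line word, with values
   starting from 1. *)
Definition is_permutation (n : nat) (s : seq nat) : bool :=
  perm_eq s (iota 1 n).

(* In the usual numbering the entry 1 of column j is in row n + 1 - a_j; matrix
   indices start from 0 here, so that row is the i with i + a_j = n. *)
Definition permutation_matrix (s : seq nat) : 'M[bool]_(size s) :=
  (\matrix_(i, j) (i + nth 0 s j == size s)%N)%R.

Definition full (s : seq nat) : bool :=
  final_config (permutation_matrix s) (const_mx true).

Definition indecomposable (s : seq nat) : bool :=
  ~~ [exists j : 'I_(size s), (0 < j) && perm_eq (take j s) (iota 1 j)].

Definition reduced (w : seq nat) : seq nat :=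
  [seq count (fun y => y <= x) w | x <- w].

Definition full_word (w : seq nat) : bool := full (reduced w).

Definition indecomposable_word (w : seq nat) : bool :=
  indecomposable (reduced w).

Definition first_component_size (w : seq nat) : nat :=
  \max_(i < (size w).+1 | indecomposable_word (take i w)) i.

(* The first argument is only fuel: a component of a nonempty word is
   nonempty, so size w steps are enough (see flatten_components). *)
Fixpoint components_rec (fuel : nat) (w : seq nat) : seq (seq nat) :=
  if fuel is fuel'.+1 then
    if w is [::] then [::] else
      let m := first_component_size w in
      take m w :: components_rec fuel' (drop m w)
  else [::].

Definition components (w : seq nat) : seq (seq nat) :=
  components_rec (size w) w.

Lemma first_component_size_gt0 x w : 0 < first_component_size (x :: w).
Proof.
have h : 1 < (size (x :: w)).+1 by [].
apply: (@bigmax_sup _ (Ordinal h)) => //=.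
rewrite take0 /indecomposable_word /reduced /= leqnn /indecomposable /=.
apply/existsP => -[[j hj] /= /andP[j0 _]].
by case: j hj j0 => [|[]].
Qed.

Lemma flatten_components w : flatten (components w) = w.
Proof.
rewrite /components; have : size w <= size w by [].
move: {2 3}(size w) => m; elim: m w => [|m IHm] [|x w] // hw.
rewrite [components_rec _ _]/= [flatten _]/= IHm ?cat_take_drop //.
move: (first_component_size_gt0 x w); case: first_component_size => //= p _.
by rewrite size_drop (leq_trans (leq_subr _ _)).
Qed.

Section FinalConfiguration.

Variable k : nat.
Implicit Types A B C : 'M[bool]_k.

Let below A B := forall i j, A i j -> B i j.

Lemma step_below A B C : stable C -> below A C -> step A B -> below B C.
Proof.
move=> /forallP stC leAC /existsP[c /andP[/andP[_ mc] /eqP ->]] i j.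
rewrite mxE => /orP[/eqP e|]; last exact: leAC.
have := stC c; rewrite /mutable negb_and negbK -e /= => /orP[//|/negP[]].
rewrite e; apply: leq_trans mc (subset_leq_card _); apply/subsetP => d.
by rewrite !inE => /andP[-> /leAC ->].
Qed.

Lemma connect_step_below A B C :
  stable C -> below A C -> connect (@step k) A B -> below B C.
Proof.
move=> stC leAC /connectP[p]; elim: p A leAC => [|D p IHp] A leAC /=.
  by move=> _ ->.
case/andP=> sAD; apply: IHp; exact: step_below sAD.
Qed.

Lemma connect_step_incr A B : connect (@step k) A B -> below A B.
Proof.
move=> /connectP[p]; elim: p A => [|D p IHp] A /=; first by move=> _ ->.
case/andP=> /existsP[c /andP[_ /eqP eD]] pD eB i j Aij.
by apply: (IHp _ pD eB); rewrite eD mxE Aij orbT.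
Qed.

Lemma final_config_unique A B C :
  final_config A B -> final_config A C -> B = C.
Proof.
case/andP=> AB stB /andP[AC stC]; apply/matrixP => i j.
apply/idP/idP; first exact: connect_step_below stC (connect_step_incr AC) AB i j.
exact: connect_step_below stB (connect_step_incr AB) AC i j.
Qed.

Lemma final_config_exists A : exists B, final_config A B.
Proof.
have [m] := ubnP #|[set c | ~~ A c.1 c.2]|; elim: m A => // m IHm A hm.
have [stA|/forallPn[c]] := boolP (stable A).
  by exists A; rewrite /final_config connect0.
rewrite negbK => mc.
have sA : step A (infect A c) by apply/existsP; exists c; rewrite mc eqxx.
have [|B /andP[cB stB]] := IHm (infect A c).
  apply: leq_trans (proper_card _) hm; apply/properP; split.
    by apply/subsetP => d; rewrite !inE mxE negb_or => /andP[].
  exists c; first by rewrite inE; case/andP: mc.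
  by rewrite inE mxE -surjective_pairing eqxx.
by exists B; rewrite /final_config stB (connect_trans (connect1 sA) cB).
Qed.

End FinalConfiguration.

(* Main.v *)
(** The key point is that a cell infected from the points of a permutation lies
    in an infected rectangle that cuts out an interval of the permutation: the
    points in its columns are exactly the points in its rows.  Indeed, if two
    such rectangles are both adjacent to a cell outside them, they overlap or
    touch, so their hull is again infected and again cuts out an interval; hence
    the union of these rectangles is closed under percolation.

    Consequently, if an infected cell is the bottom-left or top-right corner of
    the block of an indecomposable permutation, that permutation is full.  So
    when a component is not full, its percolation avoids both corners of its
    block, and adding the full blocks before and after it gives a closed set that
    contains the whole permutation and misses a cell.  Conversely, full blocks
    that touch at a corner percolate to the full square. *)
Require Import Defs.
From mathcomp Require Import all_boot all_algebra zify.

Set Implicit Arguments.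
Unset Strict Implicit.
Unset Printing Implicit Defensive.

(** * Percolation as closure on an unbounded grid *)

(** Two neighbours of a cell are either opposite each other or diagonal to one another; a diagonal
    pair has two common neighbours, hence the double conclusions. *)
Record perc_closed (A : nat -> nat -> Prop) : Prop := PercClosed {
  closed_row x y : A x y -> A x.+2 y -> A x.+1 y;
  closed_col x y : A x y -> A x y.+2 -> A x y.+1;
  closed_diag x y : A x y -> A x.+1 y.+1 -> A x.+1 y /\ A x y.+1;
  closed_antidiag x y : A x.+1 y -> A x y.+1 -> A x y /\ A x.+1 y.+1 }.

Definition rect_in (A : nat -> nat -> Prop) x0 x1 y0 y1 : Prop :=
  forall x y, x0 <= x < x1 -> y0 <= y < y1 -> A x y.

(* Cells are given as (column, row) on an unbounded grid, and a point of the
   permutation has its value as row; since a percolation never leaves the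
   bounding square of the points, dropping the boundary changes nothing. *)
Definition points (a : nat) (w : seq nat) (x y : nat) : Prop :=
  exists2 i, i < size w & x = a + i /\ y = nth 0 w i.

(** The least closed superset replaces sequences of infections: percolation is bounded from above by
    exhibiting a closed set. *)
Definition perc_closure (P : nat -> nat -> Prop) (x y : nat) : Prop :=
  forall A, perc_closed A -> (forall x y, P x y -> A x y) -> A x y.

(** Columns count from 0 and values from 1, so the block at offset [a] starts at column [a] but at
    row [a.+1]. *)
Definition spans (a : nat) (w : seq nat) : Prop :=
  rect_in (perc_closure (points a w)) a (a + size w) a.+1 (a + size w).+1.

Lemma closed_transpose A : perc_closed A -> perc_closed (fun x y => A y x).
Proof.
case=> [H V D D']; split=> [x y|x y|x y a b|x y a b].
- exact: V.
- exact: H.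
- by have [] := D _ _ a b.
- by have [] := D' _ _ b a.
Qed.

Lemma perc_closed_closure P : perc_closed (perc_closure P).
Proof.
split=> [x y a b A cA PA|x y a b A cA PA|x y a b|x y a b].
- exact: (closed_row cA (a A cA PA) (b A cA PA)).
- exact: (closed_col cA (a A cA PA) (b A cA PA)).
- by split=> A cA PA; have [] := closed_diag cA (a A cA PA) (b A cA PA).
- by split=> A cA PA; have [] := closed_antidiag cA (a A cA PA) (b A cA PA).
Qed.

Lemma sub_perc_closure (P : nat -> nat -> Prop) x y : P x y -> perc_closure P x y.
Proof. by move=> Pxy A _; apply. Qed.

(** * Rectangles and their hulls *)

Lemma perc_closed_box x0 x1 y0 y1 :
  perc_closed (fun x y => (x0 <= x < x1) && (y0 <= y < y1)).
Proof. by split=> x y /= h1 h2; lia. Qed.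

(* [P] and [Q] are two adjacent lines of the grid, in either order and either
   direction; an infected [Q]-cell next to the segment spreads along it. *)
Lemma line_fill (P Q : nat -> Prop) y0 y1 y :
    (forall z, P z -> Q z.+1 -> Q z) -> (forall z, P z.+1 -> Q z -> Q z.+1) ->
    (forall z, y0 <= z < y1 -> P z) -> y0 <= y.+1 -> y <= y1 -> Q y ->
  forall z, y0 <= z < y1 -> Q z.
Proof.
move=> dn up fP y0y yy1 Qy z /andP[y0z zy1].
case: (leqP y z) => [yz|/ltnW yz].
  rewrite -(subnKC yz); have: y + (z - y) < y1 by lia.
  elim: (z - y) => [|k IHk] hk; first by rewrite addn0.
  by rewrite addnS; apply: up; [apply: fP; lia|apply: IHk; lia].
have: y0 <= y - (y - z) by lia.
rewrite -[in Q z](subKn yz); have: y - z <= y by lia.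
elim: (y - z) => [|k IHk] hk h0; first by rewrite subn0.
apply: dn; first by apply: fP; lia.
have -> : (y - k.+1).+1 = y - k by lia.
by apply: IHk; lia.
Qed.

(** Columns are added one at a time: each new column of the hull meets the second rectangle in a
    cell level with, or just beyond, the filled neighbouring column, and [line_fill] spreads it. *)
Lemma row_hull A x0 x1 y0 y1 u0 u1 v0 v1 :
    perc_closed A -> rect_in A x0 x1 y0 y1 -> rect_in A u0 u1 v0 v1 ->
    x0 < x1 -> v0 < v1 -> x0 <= u1 -> u0 <= x1 -> y0 <= v1 -> v0 <= y1 ->
  rect_in A (minn x0 u0) (maxn x1 u1) y0 y1.
Proof.
move=> cA R1 R2 x01 v01 xu ux yv vy x y /andP[hx0 hx1] hy.
(* Row [maxn v0 y0.-1] belongs to the second rectangle and lies in the segment or next to it. *)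
have step (P Q : nat -> Prop) : (forall z, P z -> Q z.+1 -> Q z) ->
    (forall z, P z.+1 -> Q z -> Q z.+1) ->
    (forall z, y0 <= z < y1 -> P z) -> Q (maxn v0 y0.-1) ->
    forall z, y0 <= z < y1 -> Q z.
  by move=> h1 h2 h3 h4; apply: (line_fill h1 h2 h3 _ _ h4); lia.
case: (ltnP x x1) => [xx1|x1x]; last first.
  move: y hy; have: x1.-1 + (x - x1.-1) < maxn x1 u1 by lia.
  have {2}-> : x = x1.-1 + (x - x1.-1) by lia.
  elim: (x - x1.-1) => [|k IHk] hk; first by move=> y hy; apply: R1; lia.
  apply: (step (A (x1.-1 + k))); rewrite ?addnS.
  - by move=> z a b; have [] := closed_diag cA a b.
  - by move=> z a b; have [] := closed_antidiag cA b a.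
  - by apply: IHk; lia.
  - by apply: R2; lia.
case: (leqP x0 x) => [x0x|xx0]; first by apply: R1; lia.
move: y hy; have: minn x0 u0 <= x0 - (x0 - x) by lia.
have {2}-> : x = x0 - (x0 - x) by lia.
have: x0 - x <= x0 by lia.
elim: (x0 - x) => [|k IHk] hk' hk; first by move=> y hy; apply: R1; lia.
apply: (step (A (x0 - k))).
- move=> z; have -> : x0 - k = (x0 - k.+1).+1 by lia.
  by move=> a b; have [] := closed_antidiag cA a b.
- move=> z; have -> : x0 - k = (x0 - k.+1).+1 by lia.
  by move=> a b; have [] := closed_diag cA b a.
- by apply: IHk; lia.
- by apply: R2; lia.
Qed.

(** The first rectangle is widened to all columns of the hull, then, after transposing, to all rows.
    The non-strict bounds allow contact at a corner only. *)
Lemma rect_hull A x0 x1 y0 y1 u0 u1 v0 v1 :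
    perc_closed A -> rect_in A x0 x1 y0 y1 -> rect_in A u0 u1 v0 v1 ->
    x0 < x1 -> y0 < y1 -> u0 < u1 -> v0 < v1 ->
    x0 <= u1 -> u0 <= x1 -> y0 <= v1 -> v0 <= y1 ->
  rect_in A (minn x0 u0) (maxn x1 u1) (minn y0 v0) (maxn y1 v1).
Proof.
move=> cA R1 R2 x01 y01 u01 v01 xu ux yv vy x y hx hy.
have R := row_hull cA R1 R2 x01 v01 xu ux yv vy.
apply: (row_hull (u0 := v0) (u1 := v1) (v0 := u0) (v1 := u1)
          (closed_transpose cA) _ _ y01 u01 yv vy _ _ hy hx); try lia.
- by move=> s t hs ht; apply: R.
- by move=> s t hs ht; apply: R2.
Qed.

(** * Blocks along the diagonal and their corners *)

Lemma perc_closure_points_box a (w : seq nat) x y :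
  perm_eq w (iota a.+1 (size w)) -> perc_closure (points a w) x y ->
  (a <= x < a + size w) && (a.+1 <= y < (a + size w).+1).
Proof.
move=> pw /(_ _ (perc_closed_box a (a + size w) a.+1 (a + size w).+1)); apply.
move=> _ _ [i iw [-> ->]].
have: nth 0 w i \in iota a.+1 (size w) by rewrite -(perm_mem pw) mem_nth.
by rewrite mem_iota /=; lia.
Qed.

Lemma spans_cat a u v : spans a u -> spans (a + size u) v -> spans a (u ++ v).
Proof.
move=> su sv; have cA := perc_closed_closure (points a (u ++ v)).
have mono b w : (forall x y, points b w x y -> points a (u ++ v) x y) ->
    spans b w -> rect_in (perc_closure (points a (u ++ v))) b (b + size w)
                   b.+1 (b + size w).+1.
  by move=> h sw x y hx hy; apply: (sw x y hx hy) => // s t /h; apply: sub_perc_closure.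
have {su} Ru : rect_in (perc_closure (points a (u ++ v))) a (a + size u)
                   a.+1 (a + size u).+1.
  apply: mono su => x y [i iu [-> ->]]; exists i.
    by rewrite size_cat ltn_addr.
  by rewrite nth_cat iu.
have {sv} Rv : rect_in (perc_closure (points a (u ++ v))) (a + size u)
     (a + size u + size v) (a + size u).+1 (a + size u + size v).+1.
  apply: mono sv => x y [i iv [-> ->]]; exists (size u + i).
    by rewrite size_cat ltn_add2l.
  by rewrite nth_cat addnA ltnNge leq_addr /= addKn.
(* Empty words are set aside because [rect_hull] needs nonempty rectangles. *)
case: (posnP (size u)) => [u0|u0].
  by rewrite /spans size_cat u0 addn0 /= in Rv *.
case: (posnP (size v)) => [v0|v0].
  by rewrite /spans size_cat v0 addn0 /= in Ru *.
move=> x y; rewrite size_cat => hx hy.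
by apply: (rect_hull cA Ru Rv); lia.
Qed.

(** An infected corner lies in an infected rectangle that cuts out an interval. Such a rectangle at
    a corner of the block splits off a prefix, so indecomposability makes it the whole block. *)
Lemma indecomposable_corner a (w : seq nat) (P := perc_closure (points a w)) :
    perm_eq w (iota a.+1 (size w)) ->
    (forall j, 0 < j < size w -> ~~ perm_eq (take j w) (iota a.+1 j)) ->
  P a a.+1 \/ P (a + (size w).-1) (a + size w) -> spans a w.
Proof.
move=> pw indw corner.
(* [U] is the union of the infected rectangles that cut out an interval. *)
pose interval x0 x1 y0 y1 := forall i, i < size w ->
  (x0 <= a + i < x1) = (y0 <= nth 0 w i < y1).
pose inbox x0 x1 y0 y1 :=
  [&& a <= x0, x0 < x1, x1 <= a + size w, a < y0, y0 < y1 & y1 <= (a + size w).+1].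
pose U x y := exists x0 x1 y0 y1,
  [/\ inbox x0 x1 y0 y1, interval x0 x1 y0 y1, rect_in P x0 x1 y0 y1
    & (x0 <= x < x1) && (y0 <= y < y1)].
have cP : perc_closed P := perc_closed_closure _.
have uw : uniq w by rewrite (perm_uniq pw) iota_uniq.
have range i : i < size w -> a < nth 0 w i <= a + size w.
  move=> iw; have: nth 0 w i \in iota a.+1 (size w).
    by rewrite -(perm_mem pw) mem_nth.
  by rewrite mem_iota; lia.
have surj y : a < y <= a + size w -> exists2 i, i < size w & nth 0 w i = y.
  move=> hy; apply/nthP; rewrite (perm_mem pw) mem_iota; lia.
(* The two cells differ by at most one in each coordinate, so their rectangles overlap or touch, and
   the hull contains both mixed cells. *)
have hullU x y x' y' : x <= x'.+1 -> x' <= x.+1 -> y <= y'.+1 -> y' <= y.+1 ->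
    U x y -> U x' y' -> U x y' /\ U x' y.
  move=> h1 h2 h3 h4 [x0 [x1 [y0 [y1 [b1 i1 R1 m1]]]]].
  move=> [u0 [u1 [v0 [v1 [b2 i2 R2 m2]]]]]; rewrite /inbox in b1 b2.
  have R : rect_in P (minn x0 u0) (maxn x1 u1) (minn y0 v0) (maxn y1 v1).
    by apply: rect_hull cP R1 R2 _ _ _ _ _ _ _ _; lia.
  have I : interval (minn x0 u0) (maxn x1 u1) (minn y0 v0) (maxn y1 v1).
    by move=> i iw; move: (i1 i iw) (i2 i iw); lia.
  by split; exists (minn x0 u0), (maxn x1 u1), (minn y0 v0), (maxn y1 v1);
    split=> //; rewrite /inbox; lia.
have cU : perc_closed U.
  split=> [x y|x y|x y h1 h2|x y h1 h2].
  - move=> [x0 [x1 [y0 [y1 [b1 i1 R1 m1]]]]] [u0 [u1 [v0 [v1 [b2 i2 R2 m2]]]]].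
    (* The point of row [y] lies in both rectangles, so their column ranges overlap and cover
       [x.+1]. *)
    have [|i iw e] := surj y; first by rewrite /inbox in b1; lia.
    have := i1 i iw; have := i2 i iw; rewrite e => e2 e1.
    case: (ltnP x.+1 x1) => h.
      by exists x0, x1, y0, y1; split=> //; lia.
    by exists u0, u1, v0, v1; split=> //; lia.
  - move=> [x0 [x1 [y0 [y1 [b1 i1 R1 m1]]]]] [u0 [u1 [v0 [v1 [b2 i2 R2 m2]]]]].
    have iw : x - a < size w by rewrite /inbox in b1; lia.
    have := i1 _ iw; have := i2 _ iw.
    have -> : a + (x - a) = x by rewrite /inbox in b1; lia.
    move=> e2 e1.
    case: (ltnP y.+1 y1) => h.
      by exists x0, x1, y0, y1; split=> //; lia.
    by exists u0, u1, v0, v1; split=> //; lia.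
  - by case: (hullU _ _ _ _ _ _ _ _ h1 h2) => //; lia.
  - by case: (hullU _ _ _ _ _ _ _ _ h1 h2) => //; lia.
have PU x y : P x y -> U x y.
  move=> /(_ U cU); apply=> _ _ [i iw [-> ->]].
  exists (a + i), (a + i).+1, (nth 0 w i), (nth 0 w i).+1; split.
  - by rewrite /inbox; move: (range i iw); lia.
  - move=> j jw; have: (nth 0 w i == nth 0 w j) = (i == j) by rewrite nth_uniq.
    by lia.
  - move=> x' y' hx hy; apply: sub_perc_closure; exists i; first by [].
    by split; lia.
  - by lia.
(* The first [j] positions carry exactly the values up to [a + b]; comparing sizes gives [j = b],
   against indecomposability. *)
have noprefix j b : b <= size w ->
    (forall i, i < size w -> (i < j) = (nth 0 w i <= a + b)) ->
    0 < j < size w -> False.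
  move=> bw hj jw; have szt : size (take j w) = j by rewrite size_takel; lia.
  have p : perm_eq (take j w) (iota a.+1 b).
    apply: uniq_perm; rewrite ?iota_uniq ?take_uniq // => y.
    rewrite mem_iota; apply/idP/idP => [/(nthP 0)[i]|hy].
      rewrite szt => ij; rewrite nth_take // => ey; have {ey}<- : nth 0 w i = y := ey.
      have iw : i < size w by lia.
      by move: (hj i iw) (range i iw); lia.
    have [|i iw e] := surj y; first by lia.
    have ij : i < j by move: (hj i iw); rewrite e; lia.
    by rewrite -e -(nth_take 0 ij) mem_nth // szt.
  have := indw j jw; have := perm_size p; rewrite szt size_iota => jb.
  by rewrite {2}jb p.
case: corner => /PU [x0 [x1 [y0 [y1 [b i R m]]]]]; rewrite /inbox in b.
(* At the bottom-left corner, the prefix consists of the columns of the rectangle. *)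
- have xw : x1 = a + size w.
    case: (ltnP x1 (a + size w)) => h; last by lia.
    case: (noprefix (x1 - a) (y1 - a).-1); [lia| |lia].
    by move=> k kw; move: (i k kw) (range k kw); lia.
  have yw : y1 = (a + size w).+1.
    have [|k kw e] := surj (a + size w); first by lia.
    by move: (i k kw); rewrite e; lia.
  by move=> x y hx hy; apply: R; lia.
(* At the top-right corner, the prefix is the complement: the columns to the left hold exactly the
   values below. *)
- have xw : x0 = a.
    case: (ltnP a x0) => h; last by lia.
    case: (noprefix (x0 - a) (y0 - a).-1); [lia| |lia].
    by move=> k kw; move: (i k kw) (range k kw); lia.
  have yw : y0 = a.+1.
    have [|k kw e] := surj a.+1; first by lia.
    by move: (i k kw); rewrite e; lia.
  by move=> x y hx hy; apply: R; lia.
Qed.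

(** The closed set [K] joins the percolation of [c] to the full squares [low] and [up] of [u] and
    [v], which miss the columns of [c]. Contact is possible only at two corners of the square of
    [c]. *)
Lemma spans_indecomposable_factor a (u c v : seq nat) (b := a + size u) :
    perm_eq u (iota a.+1 (size u)) ->
    perm_eq c (iota b.+1 (size c)) ->
    perm_eq v (iota (b + size c).+1 (size v)) ->
    (forall j, 0 < j < size c -> ~~ perm_eq (take j c) (iota b.+1 j)) ->
  spans a (u ++ c ++ v) -> spans b c.
Proof.
move=> pu pc pv indc sw; set e := b + size c in pv *.
case: (posnP (size c)) => [c0|c0].
  by move=> x y; rewrite c0; lia.
have inb x y := @perc_closure_points_box b c x y pc.
have corner := indecomposable_corner pc indc.
pose low x y := (a <= x < b) && (a < y <= b).
pose up x y := (e <= x < e + size v) && (e < y <= e + size v).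
(* The disjunct [spans b c] is the conclusion: it is what an infected corner
   provides, and it makes [K] closed without a case analysis on fullness. *)
pose K x y := spans b c \/ (perc_closure (points b c) x y \/ (low x y || up x y)).
have cP := perc_closed_closure (points b c).
have mem (w : seq nat) k i : perm_eq w (iota k.+1 (size w)) -> i < size w ->
    k < nth 0 w i <= k + size w.
  move=> pw iw; have: nth 0 w i \in iota k.+1 (size w).
    by rewrite -(perm_mem pw) mem_nth.
  by rewrite mem_iota; lia.
have cK : perc_closed K.
  split=> x y [s|[p|l]] [s'|[p'|l']]; try (by split; left); try by left.
  - by right; left; apply: closed_row p p'.
  - by move: (inb _ _ p) l'; rewrite /low /up /e; lia.
  - by move: (inb _ _ p') l; rewrite /low /up /e; lia.
  - by right; right; move: l l'; rewrite /low /up /e; lia.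
  - by right; left; apply: closed_col p p'.
  - by move: (inb _ _ p) l'; rewrite /low /up /e; lia.
  - by move: (inb _ _ p') l; rewrite /low /up /e; lia.
  - by right; right; move: l l'; rewrite /low /up /e; lia.
  - by have [] := closed_diag cP p p'; split; right; left.
  (* A cell of the square of [c] diagonally below a cell of [up] is its top-right corner. *)
  - have s : spans b c; last by split; left.
    apply: corner; right; move: (inb _ _ p) l'; rewrite /low /up /e => h h'.
    have hx : x = b + (size c).-1 by lia.
    have hy : y = b + size c by lia.
    by rewrite hx hy in p.
  - have s : spans b c; last by split; left.
    apply: corner; left; move: (inb _ _ p') l; rewrite /low /up /e => h h'.
    have hx : x.+1 = b by lia.
    have hy : y.+1 = b.+1 by lia.
    by rewrite hx hy in p'.
  - by split; right; right; move: l l'; rewrite /low /up /e; lia.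
  - by have [] := closed_antidiag cP p p'; split; right; left.
  - by move: (inb _ _ p) l'; rewrite /low /up /e; lia.
  - by move: (inb _ _ p') l; rewrite /low /up /e; lia.
  - by split; right; right; move: l l'; rewrite /low /up /e; lia.
have PK x y : points a (u ++ c ++ v) x y -> K x y.
  move=> [i iw [-> ->]]; right; move: iw; rewrite !size_cat !nth_cat.
  case: (ltnP i (size u)) => [iu _|ui iw].
    by right; move: (mem _ _ _ pu iu); rewrite /low; lia.
  case: (ltnP (i - size u) (size c)) => [ic|ci].
    by left; apply: sub_perc_closure; exists (i - size u) => //; split=> //; lia.
  have iv : i - size u - size c < size v by lia.
  by right; move: (mem _ _ _ pv iv); rewrite /up; lia.
move=> x y hx hy.
have [||s|[//|l]] := sw x y _ _ K cK PK.
- by rewrite !size_cat; lia.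
- by rewrite !size_cat; lia.
- exact: s.
- by move: l; rewrite /low /up /e; lia.
Qed.

(** * From matrix percolation to closed sets *)

(** Matrix cell [(i, j)] becomes grid cell [(j, k - i)], rows being read from the bottom; the four
    closure rules cover every pair of distinct neighbours. *)
Lemma perc_closed_adjacent k (A : nat -> nat -> Prop) (c d e : 'I_k * 'I_k) :
    perc_closed A -> adjacent c d -> adjacent c e -> d != e ->
    A d.2 (k - d.1) -> A e.2 (k - e.1) -> A c.2 (k - c.1).
Proof.
case: c d e => [i j] [i1 j1] [i2 j2] [R C D D'].
rewrite /adjacent xpair_eqE -!val_eqE /=.
have := ltn_ord i; have := ltn_ord i1; have := ltn_ord i2.
move: (i : nat) (j : nat) (i1 : nat) (j1 : nat) (i2 : nat) (j2 : nat).
move=> {i j i1 j1 i2 j2} i j i1 j1 i2 j2 li2 li1 li h1 h2 ne A1 A2.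
have nb i' j' : i' < k ->
  (i == i') && ((j.+1 == j') || (j'.+1 == j))
  || (j == j') && ((i.+1 == i') || (i'.+1 == i)) ->
  [\/ j' = j.+1 /\ k - i' = k - i, j = j'.+1 /\ k - i' = k - i,
      j' = j /\ k - i' = (k - i).+1 | j' = j /\ k - i = (k - i').+1].
  move=> li'; case: (ltngtP j' j) => [hj|hj|hj] h.
  - by constructor 2; lia.
  - by constructor 1; lia.
  - case: (ltnP i i') => hi; first by constructor 4; lia.
    by constructor 3; lia.
have ne' : (j1 != j2) || (k - i1 != k - i2) by lia.
have {h1} := nb _ _ li1 h1; have {h2 nb} := nb _ _ li2 h2.
move: A1 A2 ne' {ne li li1 li2}.
move: (k - i1) (k - i2) (k - i) => y1 y2 y A1 A2 ne.
case=> -[e1 e2] [] [e3 e4]; subst; try by lia.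
all: try by [apply: R|apply: C].
all: try by have [] := D _ _ A1 A2.
all: try by have [] := D _ _ A2 A1.
all: try by have [] := D' _ _ A1 A2.
all: by have [] := D' _ _ A2 A1.
Qed.

Lemma connect_step_perc_closed k (A : nat -> nat -> Prop) (M N : 'M[bool]_k) :
    perc_closed A -> (forall i j, M i j -> A j (k - i)) ->
  connect (@step k) M N -> forall i j, N i j -> A j (k - i).
Proof.
move=> cA MA /connectP[p]; elim: p M MA => [|M' p IHp] M MA /=.
  by move=> _ ->.
case/andP=> /existsP[c /andP[/andP[_ /card_gt1P[d [e [hd he de]]]] /eqP ->]].
move: hd he; rewrite !inE => /andP[cd Md] /andP[ce Me]; apply: IHp => i j.
rewrite mxE => /orP[/eqP ec|/MA//].
by have := perc_closed_adjacent cA cd ce de (MA _ _ Md) (MA _ _ Me); rewrite -ec.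
Qed.

Lemma stable_adjacent k (B : 'M[bool]_k) (i j i1 j1 i2 j2 : 'I_k) :
    stable B -> B i1 j1 -> B i2 j2 -> i1 <> i2 :> nat \/ j1 <> j2 :> nat ->
  adjacent (i, j) (i1, j1) -> adjacent (i, j) (i2, j2) -> B i j.
Proof.
move=> /forallP/(_ (i, j)); rewrite /mutable negb_and negbK /=.
case/orP=> [//|/negP st] B1 B2 ne h1 h2; case: st; apply/card_gt1P.
exists (i1, j1), (i2, j2); rewrite !inE h1 h2 /= B1 B2; split=> //.
by apply/eqP=> -[e1 e2]; case: ne; rewrite ?e1 ?e2.
Qed.

(** Infection steps never leave a closed set containing the points; conversely, the stable final
    configuration, read on the grid, is itself such a closed set. *)
Lemma full_spans (s : seq nat) :
  perm_eq s (iota 1 (size s)) -> full s <-> spans 0 s.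
Proof.
move=> ps; have range i : i < size s -> 0 < nth 0 s i <= size s.
  move=> iw; have: nth 0 s i \in iota 1 (size s) by rewrite -(perm_mem ps) mem_nth.
  by rewrite mem_iota; lia.
split=> [/andP[sT _] x y hx hy A cA sA|sp].
  have hi : size s - y < size s by lia.
  have hj : x < size s by lia.
  have := connect_step_perc_closed cA _ sT (i := Ordinal hi) (j := Ordinal hj).
  rewrite mxE /= subKn; last by lia.
  apply=> // i j; rewrite mxE => /eqP e; apply: sA; exists j => //.
  by split=> //; lia.
have [B /andP[sB stB]] := final_config_exists (permutation_matrix s).
suff B1 : forall i j, B i j.
  have -> : full s = final_config (permutation_matrix s) B.
    by congr final_config; apply/matrixP => i j; rewrite mxE B1.
  by rewrite /final_config sB.
pose A (x y : nat) := exists i j : 'I_(size s), [/\ B i j, x = j :> nat & y = size s - i].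
have cA : perc_closed A.
  split=> x y [i1 [j1 [B1 e1 f1]]] [i2 [j2 [B2 e2 f2]]];
    have l1 := ltn_ord i1; have l2 := ltn_ord i2;
    have l3 := ltn_ord j1; have l4 := ltn_ord j2.
  - have h : x.+1 < size s by lia.
    exists i1, (Ordinal h); split=> //; apply: stable_adjacent stB B1 B2 _ _ _;
      rewrite /adjacent -?val_eqE /=; lia.
  - have h : size s - y.+1 < size s by lia.
    exists (Ordinal h), j1; split=> //=; last by lia.
    apply: stable_adjacent stB B1 B2 _ _ _;
      rewrite /adjacent -?val_eqE /=; lia.
  - by split; [exists i1, j2|exists i2, j1]; split=> //;
      apply: stable_adjacent stB B1 B2 _ _ _;
      rewrite /adjacent -?val_eqE /=; lia.
  - by split; [exists i1, j2|exists i2, j1]; split=> //;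
      apply: stable_adjacent stB B1 B2 _ _ _;
      rewrite /adjacent -?val_eqE /=; lia.
have sA x y : points 0 s x y -> A x y.
  move=> [k kw [-> ->]]; have rk := range k kw.
  have h : size s - nth 0 s k < size s by lia.
  exists (Ordinal h), (Ordinal kw); split=> //=; last by lia.
  by apply: (connect_step_incr sB); rewrite mxE /=; lia.
move=> i j; have li := ltn_ord i; have lj := ltn_ord j.
have [||i' [j' [B' e f]]] := sp j (size s - i) _ _ A cA sA; [lia..|].
have -> : i = i' by apply: val_inj => /=; have := ltn_ord i'; lia.
by have -> : j = j' by apply: val_inj.
Qed.

(** * Shifts and reduced words *)

Lemma spans_shift a (w : seq nat) :
    perm_eq w (iota a.+1 (size w)) ->
  spans 0 [seq x - a | x <- w] <-> spans a w.
Proof.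
move=> pw; have range i : i < size w -> a < nth 0 w i.
  move=> iw; have: nth 0 w i \in iota a.+1 (size w) by rewrite -(perm_mem pw) mem_nth.
  by rewrite mem_iota; lia.
split=> sp x y hx hy A cA wA.
  pose A' s t := A (a + s) (a + t).
  have cA' : perc_closed A'.
    case: cA => R C D D'; rewrite /A'; split=> s t; rewrite !addnS.
    - exact: R.
    - exact: C.
    - exact: D.
    - exact: D'.
  have PA' s t : points 0 [seq z - a | z <- w] s t -> A' s t.
    move=> [i]; rewrite size_map => iw [-> ->]; rewrite (nth_map 0) //.
    by apply: wA; exists i => //; move: (range i iw); split; lia.
  have hx' : x = a + (x - a) by lia.
  have hy' : y = a + (y - a) by lia.
  rewrite hx' hy'; apply: (sp (x - a) (y - a) _ _ A' cA' PA');
    rewrite size_map; lia.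
(* The guards keep truncated subtraction from identifying distinct cells. *)
pose A' s t := [/\ a <= s, a < t & A (s - a) (t - a)].
have cA' : perc_closed A'.
  case: cA => R C D D'; split=> s t [a1 b1 c1] [a2 b2 c2]; rewrite /A'.
  - rewrite !subSn // in c2 *; last by lia.
    by split; [lia|lia|apply: R].
  - rewrite !subSn // in c2 *; try by lia.
    by split; [lia|lia|apply: C].
  - rewrite !subSn // in c2 *; try by lia.
    by have [] := D _ _ c1 c2; split; split=> //; lia.
  - rewrite !subSn // in c1 c2 *; try by lia.
    by have [] := D' _ _ c1 c2; split; split=> //; lia.
rewrite size_map in hx hy.
have PA' s t : points a w s t -> A' s t.
  move=> [i iw [-> ->]]; have := range i iw => ri; split=> //; first by lia.
  apply: wA; exists i; rewrite ?size_map // (nth_map 0) //.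
  by split; lia.
have [||_ _] := sp (a + x) (a + y) _ _ A' cA' PA'; [lia..|].
by rewrite !addKn.
Qed.

Lemma map_subn_iota a m : [seq x - a | x <- iota a.+1 m] = iota 1 m.
Proof.
rewrite -addn1 iotaDl -map_comp -[RHS]map_id.
by apply: eq_map => x /=; rewrite addKn.
Qed.

Lemma perm_map_subn_iota a m (u : seq nat) : all (fun x => a < x) u ->
  perm_eq [seq x - a | x <- u] (iota 1 m) = perm_eq u (iota a.+1 m).
Proof.
move=> /allP hu; apply/idP/idP => [/(perm_map (addn a))|/(perm_map (subn^~ a))].
  rewrite -iotaDl addn1 -map_comp map_id_in // => x /hu /= ax.
  by rewrite subnKC // ltnW.
by rewrite map_subn_iota.
Qed.

Lemma count_leq_iota a m x :
  a <= x <= a + m -> count (fun y => y <= x) (iota a.+1 m) = x - a.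
Proof.
move=> hx; have -> : m = (x - a) + (m - (x - a)) by lia.
rewrite iotaD count_cat; set s := iota _ _; set t := iota _ _.
have /eqP -> : count (fun y => y <= x) s == size s.
  by rewrite -all_count; apply/allP => y; rewrite mem_iota; lia.
suff /eqP -> : count (fun y => y <= x) t == 0 by rewrite size_iota addn0.
rewrite -leqn0 leqNgt -has_count; apply/hasPn => y; rewrite mem_iota; lia.
Qed.

Lemma perm_iota_all_gt a m (u : seq nat) :
  perm_eq u (iota a.+1 m) -> all (fun x => a < x) u.
Proof.
by move=> pu; apply/allP => x; rewrite (perm_mem pu) mem_iota => /andP[].
Qed.

(** The larger letters of [v] do not affect ranks in [u], and within an interval the rank is the
    distance from [a]. *)
Lemma take_reduced_cat a (u v : seq nat) :
    perm_eq u (iota a.+1 (size u)) -> all (fun y => a + size u < y) v ->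
  take (size u) (reduced (u ++ v)) = [seq x - a | x <- u].
Proof.
move=> pu /allP hv; rewrite /reduced map_cat take_size_cat ?size_map //.
apply/eq_in_map => x xu; rewrite count_cat (permP pu).
move: xu; rewrite (perm_mem pu) mem_iota => hx.
rewrite count_leq_iota; last by lia.
rewrite [X in _ + X](_ : _ = 0) ?addn0 //; apply/eqP.
by rewrite -leqn0 leqNgt -has_count; apply/hasPn => y /hv; lia.
Qed.

Lemma reduced_perm_iota a (u : seq nat) :
  perm_eq u (iota a.+1 (size u)) -> reduced u = [seq x - a | x <- u].
Proof.
move=> pu; rewrite -(take_reduced_cat (v := [::]) pu) // cats0.
by rewrite take_oversize // size_map.
Qed.

Lemma indecomposable_wordP a (w : seq nat) : perm_eq w (iota a.+1 (size w)) ->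
  reflect (forall j, 0 < j < size w -> ~~ perm_eq (take j w) (iota a.+1 j))
          (indecomposable_word w).
Proof.
move=> pw; rewrite /indecomposable_word (reduced_perm_iota pw) /indecomposable.
have e j : perm_eq (take j [seq x - a | x <- w]) (iota 1 j)
           = perm_eq (take j w) (iota a.+1 j).
  rewrite -map_take perm_map_subn_iota //; apply/allP => x /mem_take.
  by move: x; apply/allP/(perm_iota_all_gt pw).
apply: (iffP existsPn) => [h j /andP[j0]|h [j /=]].
  rewrite -(size_map (fun x => x - a)) => jw.
  by have := h (Ordinal jw); rewrite /= j0 e.
by rewrite size_map e => jw; case: posnP => //= j0; apply: h; rewrite j0.
Qed.

Lemma full_word_spans a (w : seq nat) :
  perm_eq w (iota a.+1 (size w)) -> full_word w <-> spans a w.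
Proof.
move=> pw; rewrite -(spans_shift pw) /full_word (reduced_perm_iota pw).
apply: full_spans; rewrite size_map perm_map_subn_iota //.
exact: perm_iota_all_gt pw.
Qed.

(** * Splitting off components *)

Lemma perm_drop_iota a m (w : seq nat) : m <= size w ->
    perm_eq w (iota a.+1 (size w)) -> perm_eq (take m w) (iota a.+1 m) ->
  perm_eq (drop m w) (iota (a + m).+1 (size (drop m w))).
Proof.
move=> mw; rewrite -{1}(cat_take_drop m w) size_drop -{1}(subnKC mw) iotaD.
move=> p pt; rewrite -addSn -(perm_cat2l (take m w)) (permPl p).
by rewrite perm_cat2r perm_sym.
Qed.

(** For nonempty [w], the longest indecomposable prefix is the shortest nonempty prefix permuting
    its interval: minimality makes the latter indecomposable, and any longer prefix decomposes at
    it. *)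
Lemma first_component_perm a (w : seq nat) (m := first_component_size w) :
    perm_eq w (iota a.+1 (size w)) ->
  [/\ m <= size w, perm_eq (take m w) (iota a.+1 m)
    & indecomposable_word (take m w)].
Proof.
move=> pw; case: (posnP (size w)) => [/size0nil w0|w0].
  rewrite /m w0 /first_component_size; set k := \max_(_ < _ | _) _.
  have -> : k = 0 by apply/eqP; rewrite -leqn0; apply/bigmax_leqP => -[[|i]].
  by split=> //; apply/(indecomposable_wordP (a := a)) => // j /=; lia.
have exj : exists j, (0 < j <= size w) && perm_eq (take j w) (iota a.+1 j).
  by exists (size w); rewrite w0 leqnn take_size.
case: (ex_minnP exj) => j /andP[/andP[j0 jw] pj] minj.
have szj : size (take j w) = j by rewrite size_takel.
have indj : indecomposable_word (take j w).
  apply/(indecomposable_wordP (a := a)); rewrite szj // => i /andP[i0 ij].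
  rewrite take_takel; last exact: ltnW.
  apply/negP => pi; have := minj i; rewrite i0 pi andbT; lia.
suff mj : m = j by rewrite mj.
apply/eqP; rewrite eqn_leq; apply/andP; split; last first.
  have hj : j < (size w).+1 by lia.
  exact: (@leq_bigmax_cond _ _ (fun i : 'I_(size w).+1 => i : nat) (Ordinal hj)).
apply/bigmax_leqP => -[i iw] /= indi; rewrite leqNgt; apply/negP => ji.
have szi : size (take i w) = i by rewrite size_takel.
move: indi; rewrite /indecomposable_word => /existsPn.
have hj : j < size (reduced (take i w)) by rewrite size_map szi.
move/(_ (Ordinal hj)); rewrite /= j0 => /negP; apply.
(* The longer prefix need not permute an interval, but its first [j] letters do and all its other
   letters are larger. *)
have -> : take i w = take j w ++ take (i - j) (drop j w).
  by rewrite -takeD subnKC // ltnW.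
rewrite -{1}szj (take_reduced_cat (a := a)) ?szj //.
  by rewrite perm_map_subn_iota //; apply: perm_iota_all_gt pj.
apply/allP => y /mem_take; move: y; apply/allP.
exact: perm_iota_all_gt (perm_drop_iota jw pw pj).
Qed.

(** Puts a component in the form required by [spans_indecomposable_factor]; [u] gathers the earlier
    components and [v] the later ones. *)
Lemma components_rec_split fuel a (w c : seq nat) :
    perm_eq w (iota a.+1 (size w)) -> c \in components_rec fuel w ->
  exists u v, [/\ w = u ++ c ++ v, perm_eq u (iota a.+1 (size u)),
    perm_eq c (iota (a + size u).+1 (size c)),
    perm_eq v (iota (a + size u + size c).+1 (size v)) & indecomposable_word c].
Proof.
elim: fuel a w => [|fuel IHf] a [|x w'] //=; set w := x :: w' => pw.
have [mw pm indm] := first_component_perm pw; set m := first_component_size w in mw pm indm *.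
have szm : size (take m w) = m by rewrite size_takel.
have pd := perm_drop_iota mw pw pm.
rewrite inE => /orP[/eqP ->|/(IHf _ _ pd)[u [v [e pu pc pv indc]]]].
  by exists [::], (drop m w); rewrite cat_take_drop !addn0 szm.
exists (take m w ++ u), v; split=> //.
- by rewrite -catA -e cat_take_drop.
- by rewrite size_cat szm iotaD perm_cat // -addSn.
- by rewrite size_cat szm addnA.
- by rewrite size_cat szm addnA.
Qed.

Lemma spans_components fuel a (w : seq nat) : size w <= fuel ->
    perm_eq w (iota a.+1 (size w)) ->
    (forall c, c \in components_rec fuel w -> full_word c) -> spans a w.
Proof.
elim: fuel a w => [|fuel IHf] a [|x w'] //=; try by move=> _ _ _ s t /=; lia.
set w := x :: w' => hw pw h.
have [mw pm indm] := first_component_perm pw.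
have m0 := first_component_size_gt0 x w' : 0 < first_component_size w.
set m := first_component_size w in mw pm indm m0 h.
have szm : size (take m w) = m by rewrite size_takel.
rewrite -(cat_take_drop m w); apply: spans_cat.
  by apply/full_word_spans; rewrite ?szm //; apply: h; rewrite inE eqxx.
rewrite szm; apply: IHf.
- by rewrite size_drop /=; lia.
- exact: perm_drop_iota.
- by move=> c hc; apply: h; rewrite inE hc orbT.
Qed.

Theorem theorem4p11 (n : nat) (hn : 1 <= n) (pi : seq nat)
    (hpi : is_permutation n pi) :
  full pi <-> (forall c : seq nat, c \in components pi -> full_word c).
Proof.
have ppi : perm_eq pi (iota 1 (size pi)).
  by rewrite (perm_size hpi) size_iota.
rewrite (full_spans ppi); split=> [sp c|]; last exact: spans_components.
move=> /(components_rec_split ppi)[u [v [e pu pc pv indc]]].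
apply/(full_word_spans pc); rewrite e in sp.
exact: spans_indecomposable_factor pu pc pv (indecomposable_wordP pc indc) sp.
Qed.
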